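(* Let $(M^{2n+1},\phi,\xi,\eta,g,\nabla,\nabla^{*})$ be an almost cosymplectic statistical manifold, and let $\mathcal{A}X=-\nabla_{X}\xi$, $\mathcal{A}^{*}X=-\nabla^{*}_{X}\xi$. Then, for all vector fields $X,Y$ on $M$, $$R(X,Y)\xi=(\nabla_{Y}\mathcal{A})X-(\nabla_{X}\mathcal{A})Y,$$ $$R^{*}(X,Y)\xi=(\nabla^{*}_{Y}\mathcal{A}^{*})X-(\nabla^{*}_{X}\mathcal{A}^{*})Y.$$
   Context: A statistical manifold $(M,g,\nabla,\nabla^{*})$ is a Riemannian manifold $(M,g)$ with torsion-free affine connections $\nabla,\nabla^{*}$ satisfying $Zg(X,Y)=g(\nabla_{Z}X,Y)+g(X,\nabla^{*}_{Z}Y)$ for all vector fields $X,Y,Z$. An almost contact metric manifold $(M^{2n+1},\phi,\xi,\eta,g)$ has a $(1,1)$-tensor field $\phi$, a vector field $\xi$, a 1-form $\eta$ and a Riemannian metric $g$ with $\phi^{2}=-\mathrm{Id}+\eta\otimes\xi$, $\eta(\xi)=1$, $g(\phi X,\phi Y)=g(X,Y)-\eta(X)\eta(Y)$. Its fundamental form is $\Phi(X,Y)=g(\phi X,Y)$. It is almost cosymplectic if $d\eta=0$ and $d\Phi=0$. An almost cosymplectic statistical manifold is a statistical manifold $(M,g,\nabla,\nabla^{*})$ together with an almost cosymplectic structure $(\phi,\xi,\eta,g)$ with the same metric $g$. $R$ and $R^{*}$ are the curvature tensors of $\nabla$ and $\nabla^{*}$, with $R(X,Y)Z=\nabla_{X}\nabla_{Y}Z-\nabla_{Y}\nabla_{X}Z-\nabla_{[X,Y]}Z$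 and similarly for $R^{*}$. *)

(* Defs.v *)
(* MathComp-Analysis: smooth manifolds over an arbitrary [R : realType]. *)
From HB Require Import structures.
From mathcomp Require Import all_boot all_order all_algebra.
From mathcomp Require Import all_classical all_reals all_analysis.
From mathcomp Require Import ring.

Set Implicit Arguments.
Unset Strict Implicit.
Unset Printing Implicit Defensive.

Import Order.TTheory GRing.Theory Num.Theory.
Import numFieldNormedType.Exports.

Local Open Scope classical_set_scope.
Local Open Scope ring_scope.

Section euclidean.
Variables (R : realType) (m : nat).
Implicit Types (U : set 'rV[R]_m) (f g : 'rV[R]_m -> R).

(* Class C^k on [U], meaningful when [U] is open: all iterated partial
   derivatives of order at most [k] exist and are continuous on [U]. *)
Fixpoint Ck (k : nat) U f : Prop :=
  (forall x, U x -> {for x, continuous f}) /\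
  match k with
  | 0%N => True
  | k'.+1 => forall i : 'I_m,
      (forall x, U x -> derivable f x (delta_mx 0 i)) /\
      Ck k' U ('D_(delta_mx 0 i) f)
  end.

Definition smooth_on U f : Prop := forall k, Ck k U f.

Lemma near_eq_open U f g x : open U -> (forall y, U y -> f y = g y) ->
  U x -> {near x, f =1 g}.
Proof.
move=> oU fg Ux; apply: (filterS fg).
exact: open_nbhs_nbhs.
Qed.

Lemma Ck_eq k U f g : open U -> (forall x, U x -> f x = g x) ->
  Ck k U f -> Ck k U g.
Proof.
move=> oU; elim: k f g => [|k IH] f g fg [cf df].
  split=> // x Ux; rewrite /prop_for /continuous_at -(fg _ Ux).
  apply: cvg_trans (cf _ Ux).
  exact: near_eq_cvg (near_eq_open oU fg Ux).
split=> [x Ux|i].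
  rewrite /prop_for /continuous_at -(fg _ Ux).
  apply: cvg_trans (cf _ Ux).
  exact: near_eq_cvg (near_eq_open oU fg Ux).
have [dfi Cfi] := df i; split=> [x Ux|].
  exact: near_eq_derivable (near_eq_open oU fg Ux) (dfi _ Ux).
apply: IH Cfi => x Ux; exact: near_eq_derive (near_eq_open oU fg Ux).
Qed.

Lemma CkW k U f : Ck k.+1 U f -> Ck k U f.
Proof.
elim: k f => [|k IH] f [cf df]; first by split.
by split=> // i; have [dfi Cfi] := df i; split=> //; exact: IH.
Qed.

Lemma Ck_cst k U (a : R) : open U -> Ck k U (cst a).
Proof.
move=> oU; elim: k a => [|k IH] a;
  (split; first by move=> x _; exact: cst_continuous).
  by [].
move=> i; split=> [x _|]; first exact: derivable_cst.
by apply: Ck_eq (IH 0) => // x _; rewrite derive_cst.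
Qed.

Lemma CkD k U f g : open U -> Ck k U f -> Ck k U g -> Ck k U (f \+ g).
Proof.
move=> oU; elim: k f g => [|k IH] f g [cf df] [cg dg];
  (split; first by move=> x Ux; apply: continuousD; [exact: cf|exact: cg]).
  by [].
move=> i; have [dfi Cfi] := df i; have [dgi Cgi] := dg i.
split=> [x Ux|]; first by apply: derivableD; [exact: dfi|exact: dgi].
apply: Ck_eq (IH _ _ Cfi Cgi) => // x Ux /=.
by rewrite -deriveD; [|exact: dfi|exact: dgi].
Qed.

Lemma CkM k U f g : open U -> Ck k U f -> Ck k U g -> Ck k U (f \* g).
Proof.
move=> oU; elim: k f g => [|k IH] f g; [move=> [cf _] [cg _]|move=> Cf Cg].
  by split=> // x Ux; apply: continuousM; [exact: cf|exact: cg].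
have [cf df] := Cf; have [cg dg] := Cg.
split; first by move=> x Ux; apply: continuousM; [exact: cf|exact: cg].
move=> i; have [dfi Cfi] := df i; have [dgi Cgi] := dg i.
split=> [x Ux|]; first by apply: derivableM; [exact: dfi|exact: dgi].
apply: Ck_eq (CkD oU (IH _ _ (CkW Cf) Cgi) (IH _ _ (CkW Cg) Cfi)) => // x Ux /=.
by rewrite (deriveM (dfi _ Ux) (dgi _ Ux)).
Qed.

End euclidean.

Section manifold.
Variables (R : realType) (m : nat).

(* A homeomorphism from an open set of [M] onto an open set of R^m;
   [chart_map] is only significant on [chart_dom], [chart_inv] on [chart_cod]. *)
Record chart (M : topologicalType) := Chart {
  chart_dom : set M;
  chart_cod : set 'rV[R]_m;
  chart_map : M -> 'rV[R]_m;
  chart_inv : 'rV[R]_m -> M;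
  chart_dom_open : open chart_dom;
  chart_cod_open : open chart_cod;
  chart_mapP : forall p, chart_dom p -> chart_cod (chart_map p);
  chart_invP : forall x, chart_cod x -> chart_dom (chart_inv x);
  chart_mapK : forall p, chart_dom p -> chart_inv (chart_map p) = p;
  chart_invK : forall x, chart_cod x -> chart_map (chart_inv x) = x;
  chart_map_continuous :
    forall p, chart_dom p -> {for p, continuous chart_map};
  chart_inv_continuous :
    forall x, chart_cod x -> {for x, continuous chart_inv}
}.

Definition smoothly_compatible (M : topologicalType) (c d : chart M) : Prop :=
  forall i : 'I_m,
    smooth_on (chart_cod c `&` chart_inv c @^-1` chart_dom d)
              (fun x => chart_map d (chart_inv c x) 0 i).

(* The atlas is not required to be maximal: it determines the smooth
   structure. *)
Record manifold := Manifold {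
  manifold_sort :> topologicalType;
  manifold_hausdorff : hausdorff_space manifold_sort;
  manifold_second_countable : @second_countable manifold_sort;
  atlas : set (chart manifold_sort);
  atlas_cover : forall p, exists2 c, atlas c & chart_dom c p;
  atlas_compatible :
    forall c d, atlas c -> atlas d -> smoothly_compatible c d
}.

End manifold.

Section smooth_functions.
Variables (R : realType) (m : nat) (M : manifold R m).

Definition smooth (f : M -> R) : Prop :=
  forall c, atlas c -> smooth_on (chart_cod c) (f \o chart_inv c).

Definition smooth_pred : {pred M -> R} := fun f => `[< smooth f >].

Record smoothfun := SmoothFun {
  smoothfun_val :> M -> R;
  smoothfunP : smoothfun_val \in smooth_pred
}.

HB.instance Definition _ := [isSub for smoothfun_val].
HB.instance Definition _ := [Choice of smoothfun by <:].

Lemma smooth_cst (a : R) : smooth (cst a).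
Proof. by move=> c _ k; apply: Ck_cst; exact: chart_cod_open. Qed.

Lemma smoothD (f g : M -> R) : smooth f -> smooth g -> smooth (f + g).
Proof.
move=> sf sg c ac k.
apply: (@CkD _ _ k _ (f \o chart_inv c) (g \o chart_inv c)).
- exact: chart_cod_open.
- exact: sf.
- exact: sg.
Qed.

Lemma smoothM (f g : M -> R) : smooth f -> smooth g -> smooth (f * g).
Proof.
move=> sf sg c ac k.
apply: (@CkM _ _ k _ (f \o chart_inv c) (g \o chart_inv c)).
- exact: chart_cod_open.
- exact: sf.
- exact: sg.
Qed.

Lemma smoothZ (a : R) (f : M -> R) : smooth f -> smooth (a *: f).
Proof. exact: smoothM (smooth_cst a). Qed.

Lemma smoothN (f : M -> R) : smooth f -> smooth (- f).
Proof. by rewrite -scaleN1r; exact: smoothZ. Qed.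

Lemma smoothB (f g : M -> R) : smooth f -> smooth g -> smooth (f - g).
Proof. by move=> sf sg; apply/smoothD/smoothN. Qed.

Lemma smooth_subring_closed : subring_closed smooth_pred.
Proof.
split=> [|f g /asboolP sf /asboolP sg|f g /asboolP sf /asboolP sg];
  apply/asboolP.
- exact: smooth_cst.
- exact: smoothB.
- exact: smoothM.
Qed.

Lemma smooth_submod_closed : submod_closed smooth_pred.
Proof.
split=> [|a f g /asboolP sf /asboolP sg]; apply/asboolP.
- exact: smooth_cst.
- exact/smoothD/sg/smoothZ.
Qed.

HB.instance Definition _ := GRing.SubChoice_isSubComPzRing.Build
  (M -> R) smooth_pred smoothfun smooth_subring_closed.
HB.instance Definition _ :=
  GRing.isSubmodClosed.Build R (M -> R) smooth_pred smooth_submod_closed.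
HB.instance Definition _ := [SubZmodule_isSubLmodule of smoothfun by <:].

End smooth_functions.

Section tangent_vectors.
Variables (R : realType) (m : nat) (M : manifold R m).
Local Notation C := (smoothfun M).

(* Tangent vectors at [p] are the R-linear derivations at [p] of the algebra
   of smooth functions. *)
Definition is_tangent (p : M) (v : C -> R) : Prop :=
  linear_for *%R v /\ forall f h : C, v (f * h) = f p * v h + h p * v f.

Definition tangent_pred p : {pred C -> R} := fun v => `[< is_tangent p v >].

Record tangent (p : M) := Tangent {
  tangent_val :> C -> R;
  tangentP : tangent_val \in tangent_pred p
}.

HB.instance Definition _ p := [isSub for @tangent_val p].
HB.instance Definition _ p := [Choice of tangent p by <:].

Lemma tangent_submod_closed p : submod_closed (tangent_pred p).
Proof.
split=> [|a v w /asboolP[lv Lv] /asboolP[lw Lw]]; apply/asboolP; split.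
- by move=> a f h; rewrite -[LHS]/(0 : R) -[RHS]/(a * 0 + 0) mulr0 addr0.
- by move=> f h; rewrite -[LHS]/(0 : R) -[RHS]/(f p * 0 + h p * 0) !mulr0 addr0.
- move=> b f h; rewrite !fctE lv lw /GRing.scale /=; ring.
- move=> f h; rewrite !fctE Lv Lw /GRing.scale /=; ring.
Qed.

HB.instance Definition _ p :=
  GRing.isSubmodClosed.Build R (C -> R) (tangent_pred p)
    (tangent_submod_closed p).
HB.instance Definition _ p := [SubChoice_isSubZmodule of tangent p by <:].
HB.instance Definition _ p := [SubZmodule_isSubLmodule of tangent p by <:].

Lemma tangent_linear p (v : tangent p) (a : R) (f h : C) :
  v (a *: f + h) = a * v f + v h.
Proof. by have /asboolP[lv _] := tangentP v; rewrite lv. Qed.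

Lemma tangentM p (v : tangent p) (f h : C) :
  v (f * h) = f p * v h + h p * v f.
Proof. by have /asboolP[_] := tangentP v; exact. Qed.

End tangent_vectors.

Section vector_fields.
Variables (R : realType) (m : nat) (M : manifold R m).
Local Notation C := (smoothfun M).

Definition vfield_pred : {pred forall p : M, tangent p} :=
  fun X => `[< forall f : C, smooth (fun p => X p f) >].

Record vfield := VField {
  vfield_val :> forall p : M, tangent p;
  vfieldP : vfield_val \in vfield_pred
}.

HB.instance Definition _ := [isSub for vfield_val].
HB.instance Definition _ := [Choice of vfield by <:].

Lemma vfield_ext (X Y : vfield) :
  (forall (p : M) (f : C), X p f = Y p f) -> X = Y.
Proof.
move=> XY; apply/val_inj/functional_extensionality_dep => p /=.
by apply/val_inj/funext => f; exact: XY.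
Qed.

Lemma vfield_smooth (X : vfield) (f : C) :
  (fun p => X p f) \in @smooth_pred R m M.
Proof. by have /asboolP sX := vfieldP X; exact/asboolP. Qed.

Definition vact (X : vfield) (f : C) : C := SmoothFun (vfield_smooth X f).

Lemma smoothfun_smooth (f : C) : smooth f.
Proof. by have /asboolP := smoothfunP f. Qed.

Lemma vf_zero_subproof : (fun p => 0) \in vfield_pred.
Proof. by apply/asboolP => f; exact: (@smooth_cst R m M 0). Qed.
Definition vf_zero := VField vf_zero_subproof.

Lemma vf_add_subproof (X Y : vfield) :
  (fun p => X p + Y p) \in vfield_pred.
Proof.
apply/asboolP => f; exact: smoothD (smoothfun_smooth (vact X f))
                                   (smoothfun_smooth (vact Y f)).
Qed.
Definition vf_add X Y := VField (vf_add_subproof X Y).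

Lemma vf_opp_subproof (X : vfield) : (fun p => - X p) \in vfield_pred.
Proof.
by apply/asboolP => f; exact: smoothN (smoothfun_smooth (vact X f)).
Qed.
Definition vf_opp X := VField (vf_opp_subproof X).

Lemma vf_scale_subproof (a : C) (X : vfield) :
  (fun p => a p *: X p) \in vfield_pred.
Proof.
apply/asboolP => f.
exact: smoothM (smoothfun_smooth a) (smoothfun_smooth (vact X f)).
Qed.
Definition vf_scale a X := VField (vf_scale_subproof a X).

Lemma vf_addA : associative vf_add.
Proof. by move=> X Y Z; apply: vfield_ext => p f; exact: addrA. Qed.
Lemma vf_addC : commutative vf_add.
Proof. by move=> X Y; apply: vfield_ext => p f; exact: addrC. Qed.
Lemma vf_add0 : left_id vf_zero vf_add.
Proof. by move=> X; apply: vfield_ext => p f; exact: add0r. Qed.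
Lemma vf_addN : left_inverse vf_zero vf_opp vf_add.
Proof. by move=> X; apply: vfield_ext => p f; exact: addNr. Qed.

HB.instance Definition _ :=
  GRing.isZmodule.Build vfield vf_addA vf_addC vf_add0 vf_addN.

Lemma vf_scaleA (a b : C) X : vf_scale a (vf_scale b X) = vf_scale (a * b) X.
Proof. by apply: vfield_ext => p f; exact: mulrA. Qed.
Lemma vf_scale1 : left_id 1 vf_scale.
Proof. by move=> X; apply: vfield_ext => p f; exact: mul1r. Qed.
Lemma vf_scaleDr : right_distributive vf_scale +%R.
Proof. by move=> a X Y; apply: vfield_ext => p f; exact: mulrDr. Qed.
Lemma vf_scaleDl X : {morph vf_scale^~ X : a b / a + b}.
Proof. by move=> a b; apply: vfield_ext => p f; exact: mulrDl. Qed.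

HB.instance Definition _ := GRing.Zmodule_isLmodule.Build C vfield
  vf_scaleA vf_scale1 vf_scaleDr vf_scaleDl.

Definition lie_at (X Y : vfield) (p : M) (f : C) : R :=
  X p (vact Y f) - Y p (vact X f).

Lemma vact_linear X (a : R) (f h : C) :
  vact X (a *: f + h) = a *: vact X f + vact X h.
Proof. by apply/val_inj/funext => p; exact: tangent_linear. Qed.

Lemma vactM X (f h : C) : vact X (f * h) = f * vact X h + h * vact X f.
Proof. by apply/val_inj/funext => p; exact: tangentM. Qed.

Lemma lie_at_subproof X Y p : lie_at X Y p \in tangent_pred p.
Proof.
apply/asboolP; split=> [a f h|f h]; rewrite /lie_at.
  by rewrite !vact_linear !tangent_linear; ring.
have vD (Z : vfield) (u w : C) : Z p (u + w) = Z p u + Z p w.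
  by rewrite -[u]scale1r tangent_linear mul1r scale1r.
by rewrite !vactM !vD !tangentM /=; ring.
Qed.

Lemma lie_subproof X Y :
  (fun p => Tangent (lie_at_subproof X Y p)) \in vfield_pred.
Proof.
apply/asboolP => f.
exact: smoothB (smoothfun_smooth (vact X (vact Y f)))
               (smoothfun_smooth (vact Y (vact X f))).
Qed.

Definition lie (X Y : vfield) : vfield := VField (lie_subproof X Y).

End vector_fields.

Section geometry.
Variables (R : realType) (m : nat) (M : manifold R m).
Local Notation C := (smoothfun M).
Local Notation VF := (vfield M).
Implicit Types X Y Z : VF.

(* Tensor fields of type (0, s) and (1, s) are C^oo(M)-multilinear maps from
   vector fields to smooth functions and to vector fields respectively. *)
Definition tensor11 := {linear VF -> VF}.
Definition oneform := {linear VF -> C | *%R}.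

Record riemannian_metric := RiemannianMetric {
  metric :> VF -> VF -> C;
  metric_linear : forall Y, linear_for *%R (metric^~ Y);
  metric_sym : forall X Y, metric X Y = metric Y X;
  metric_pos : forall X (p : M), X p != 0 -> 0 < metric X X p
}.

Record affine_connection := AffineConnection {
  nabla :> VF -> VF -> VF;
  nabla_linear : forall Y, linear (nabla^~ Y);
  nablaD : forall X, {morph nabla X : Y Z / Y + Z};
  nabla_leibniz : forall X (f : C) Y,
    nabla X (f *: Y) = vact X f *: Y + f *: nabla X Y
}.

Definition torsion_free (D : affine_connection) : Prop :=
  forall X Y, D X Y - D Y X = lie X Y.

Definition curvature (D : affine_connection) X Y Z : VF :=
  D X (D Y Z) - D Y (D X Z) - D (lie X Y) Z.

(* (D_X A) Y *)
Definition cov_tensor11 (D : affine_connection) X (A : tensor11) Y : VF :=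
  D X (A Y) - A (D X Y).

Definition neg_nabla (D : affine_connection) (xi : VF) X : VF := - D X xi.

Lemma neg_nabla_linear D xi : linear (neg_nabla D xi).
Proof.
by move=> a X Y; rewrite /neg_nabla nabla_linear opprD scalerN.
Qed.

HB.instance Definition _ D xi :=
  GRing.isLinear.Build C VF VF *:%R (neg_nabla D xi) (@neg_nabla_linear D xi).

Definition neg_nabla_tensor D xi : tensor11 := neg_nabla D xi.

Record statistical (g : riemannian_metric) (D Ds : affine_connection)
    : Prop := {
  statistical_torsion_free : torsion_free D;
  statistical_dual_torsion_free : torsion_free Ds;
  statistical_duality : forall X Y Z,
    vact Z (g X Y) = g (D Z X) Y + g X (Ds Z Y)
}.

(* Exterior derivatives of 1-forms and 2-forms, without the factors 1/2 and
   1/3 of some conventions; only their vanishing is used. *)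
Definition d_oneform (w : VF -> C) X Y : C :=
  vact X (w Y) - vact Y (w X) - w (lie X Y).

Definition d_twoform (w : VF -> VF -> C) X Y Z : C :=
  vact X (w Y Z) + vact Y (w Z X) + vact Z (w X Y)
  - w (lie X Y) Z - w (lie Y Z) X - w (lie Z X) Y.

Record almost_contact_metric (phi : tensor11) (xi : VF) (eta : oneform)
    (g : riemannian_metric) : Prop := {
  almost_contact_sqr : forall X, phi (phi X) = - X + eta X *: xi;
  almost_contact_reeb : eta xi = 1;
  almost_contact_compat : forall X Y,
    g (phi X) (phi Y) = g X Y - eta X * eta Y
}.

Definition fundamental_form (phi : tensor11) (g : riemannian_metric) X Y : C :=
  g (phi X) Y.

Record almost_cosymplectic (phi : tensor11) (xi : VF) (eta : oneform)
    (g : riemannian_metric) : Prop := {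
  cosymplectic_contact : almost_contact_metric phi xi eta g;
  cosymplectic_eta_closed : forall X Y, d_oneform eta X Y = 0;
  cosymplectic_Phi_closed : forall X Y Z,
    d_twoform (fundamental_form phi g) X Y Z = 0
}.

Record almost_cosymplectic_statistical (phi : tensor11) (xi : VF)
    (eta : oneform) (g : riemannian_metric) (D Ds : affine_connection)
    : Prop := {
  acs_statistical : statistical g D Ds;
  acs_cosymplectic : almost_cosymplectic phi xi eta g
}.

End geometry.

(* Main.v *)
Require Import Defs.
From HB Require Import structures.
From mathcomp Require Import all_boot all_order all_algebra.
From mathcomp Require Import all_classical all_reals all_analysis.

Import GRing.Theory.
Local Open Scope ring_scope.

(** The identity is a feature of any torsion-free connection [D], with an
    arbitrary vector field [Z] in place of [xi]. For [A = - D Z], expanding the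
    covariant derivatives gives
      [(D_Y A) X - (D_X A) Y
         = D_X D_Y Z - D_Y D_X Z - D_(D_X Y - D_Y X) Z],
    and vanishing torsion turns [D_X Y - D_Y X] into the Lie bracket of [X] and
    [Y], so that the right-hand side is [R(X, Y) Z]: this is
    [torsion_free_curvatureE]. Both connections of a statistical manifold are
    torsion-free, so the lemma applies to each of them. *)

Section connection.
Context {R : realType} {m : nat} {M : manifold R m}.
Implicit Types (D : affine_connection M) (X Y Z : vfield M).

Lemma nablaN D X Y : D X (- Y) = - D X Y.
Proof.
have D0 : D X 0 = 0 by apply: (addrI (D X 0)); rewrite -nablaD !addr0.
by apply/eqP; rewrite -addr_eq0 -nablaD addNr D0.
Qed.

Lemma nablaBl D X Y Z : D (X - Y) Z = D X Z - D Y Z.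
Proof. by rewrite addrC -scaleN1r nabla_linear scaleN1r addrC. Qed.

Lemma cov_neg_nablaE D X Y Z :
  cov_tensor11 D X (neg_nabla_tensor D Z) Y = D (D X Y) Z - D X (D Y Z).
Proof.
rewrite /cov_tensor11 /neg_nabla_tensor /= /neg_nabla.
by rewrite nablaN opprK addrC.
Qed.

Lemma torsion_free_curvatureE D X Y Z : torsion_free D ->
  curvature D X Y Z = cov_tensor11 D Y (neg_nabla_tensor D Z) X
                      - cov_tensor11 D X (neg_nabla_tensor D Z) Y.
Proof.
move=> tfD; rewrite /curvature -tfD nablaBl !cov_neg_nablaE !opprB.
by rewrite addrACA [RHS]addrACA; congr (_ + _); rewrite addrC.
Qed.

End connection.

Theorem theorem7 (R : realType) (n : nat) (M : manifold R (n.*2.+1))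
    (phi : tensor11 M) (xi : vfield M) (eta : oneform M)
    (g : riemannian_metric M) (D Ds : affine_connection M)
    (hM : almost_cosymplectic_statistical phi xi eta g D Ds) :
  let A := neg_nabla_tensor D xi in
  let As := neg_nabla_tensor Ds xi in
  forall X Y : vfield M,
    curvature D X Y xi = cov_tensor11 D Y A X - cov_tensor11 D X A Y /\
    curvature Ds X Y xi = cov_tensor11 Ds Y As X - cov_tensor11 Ds X As Y.
Proof.
have [tfD tfDs _] := acs_statistical hM.
by move=> A As X Y; split; exact: torsion_free_curvatureE.
Qed.
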